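(* Let $n\ge 0$ be a natural number and let $\mathcal{D}_n$ be the lattice of antichains over $\{1,\dots,n\}$. Then $$D(n+2)=\sum_{\substack{\alpha,\beta\in\mathcal{D}_n\\ \alpha\le\beta}}2^{C_{\alpha,\beta}}\,|[\bot,\alpha]|\,|[\beta,\top]| .$$
   Context: For $n\ge 0$ let $\mathcal{A}=\{1,\dots,n\}$. An antichain over $\mathcal{A}$ is a set of pairwise non-inclusive subsets of $\mathcal{A}$ (the empty set of subsets $\{\}$ and the singleton $\{\emptyset\}$ are both antichains). $\mathcal{D}_n$ is the set of all antichains over $\mathcal{A}$, and $D(n)=|\mathcal{D}_n|$ is the $n$-th Dedekind number. $\mathcal{D}_n$ is partially ordered by: $\alpha\le\beta$ iff for every $X\in\alpha$ there is $Y\in\beta$ with $X\subseteq Y$. Its smallest and largest elements are $\bot=\{\}$ and $\top=\{\{1,\dots,n\}\}$. The interval is $[\alpha,\beta]=\{\chi\in\mathcal{D}_n:\alpha\le\chi\le\beta\}$. For $\alpha\le\beta$ in $\mathcal{D}_n$, two sets $A,B\in\beta-\alpha$ (set difference) are directly connected with respect to $\alpha$ iff $\{A\cap B\}\not\le\alpha$; they are connected with respect to $\alpha$ iff they are directly connected or joined by a finite chain of sets in $\beta-\alpha$ in which consecutive sets are directly connected. $C_{\alpha,\beta}$ is the number of connected components of the graph with vertex set $\beta-\alpha$ whose edges join sets connected with respect to $\alpha$ (so $C_{\alpha,\beta}=0$ if $\alpha=\beta$). *)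

(* Defs.v *)
From HB Require Import structures.
From mathcomp Require Import all_boot all_order.

Set Implicit Arguments.
Unset Strict Implicit.
Unset Printing Implicit Defensive.

Import Order.TTheory.

Local Open Scope order_scope.

(* The ground set {1, ..., n} is represented by 'I_n. *)
Definition is_antichain (n : nat) (a : {set {set 'I_n}}) : bool :=
  [forall X in a, forall Y in a, (X \subset Y) ==> (X == Y)].

Record antichain (n : nat) : predArgType := Antichain {
  antichain_set :> {set {set 'I_n}};
  antichainP : is_antichain antichain_set
}.

HB.instance Definition _ (n : nat) := [isSub for @antichain_set n].
HB.instance Definition _ (n : nat) := [Finite of antichain n by <:].

Definition dedekind (n : nat) : nat := #|{: antichain n}|.

Lemma is_antichain0 (n : nat) : is_antichain (set0 : {set {set 'I_n}}).
Proof. by apply/forall_inP => X; rewrite inE. Qed.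

Lemma is_antichain1 (n : nat) (X : {set 'I_n}) : is_antichain [set X].
Proof.
apply/forall_inP => Y /set1P->; apply/forall_inP => Z /set1P->.
by rewrite eqxx implybT.
Qed.

Definition antichain0 (n : nat) : antichain n := Antichain (is_antichain0 n).

Definition antichain1 (n : nat) (X : {set 'I_n}) : antichain n :=
  Antichain (is_antichain1 X).

Definition antichain_le (n : nat) (a b : antichain n) : bool :=
  [forall X in antichain_set a, exists Y in antichain_set b, X \subset Y].

Lemma antichain_leP (n : nat) (a b : antichain n) :
  reflect (forall X, X \in antichain_set a ->
             exists2 Y, Y \in antichain_set b & X \subset Y)
          (antichain_le a b).
Proof.
by apply: (iffP forall_inP) => h X /h; [move/exists_inP | move=> ?; apply/exists_inP].
Qed.

Lemma antichain_le_refl (n : nat) : reflexive (@antichain_le n).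
Proof. by move=> a; apply/antichain_leP => X Xa; exists X. Qed.

Lemma antichain_le_trans (n : nat) : transitive (@antichain_le n).
Proof.
move=> b a c /antichain_leP ab /antichain_leP bc; apply/antichain_leP => X.
by case/ab => Y /bc[Z Zc YZ] XY; exists Z => //; apply: subset_trans YZ.
Qed.

Lemma antichain_le_anti (n : nat) : antisymmetric (@antichain_le n).
Proof.
have sub (a b : antichain n) : antichain_le a b -> antichain_le b a ->
    {subset antichain_set a <= antichain_set b}.
  move=> /antichain_leP ab /antichain_leP ba X Xa.
  have [Y Yb XY] := ab X Xa; have [Z Za YZ] := ba Y Yb.
  have XZ := implyP (forall_inP (forall_inP (antichainP a) X Xa) Z Za).
  have /eqP eXZ := XZ (subset_trans XY YZ).
  by have -> : X = Y by apply/eqP; rewrite eqEsubset XY {1}eXZ.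
move=> a b /andP[ab ba]; apply: val_inj; apply/setP => X /=.
by apply/idP/idP; apply: sub.
Qed.

Fact antichain_display : Order.disp_t. Proof. exact: Order.Disp tt tt. Qed.

HB.instance Definition _ (n : nat) :=
  Order.Le_isPOrder.Build antichain_display (antichain n)
    (@antichain_le_refl n) (@antichain_le_anti n) (@antichain_le_trans n).

Lemma antichain_le0x (n : nat) (a : antichain n) : antichain0 n <= a.
Proof. by apply/antichain_leP => X; rewrite inE. Qed.

Lemma antichain_lex1 (n : nat) (a : antichain n) : a <= antichain1 [set: 'I_n].
Proof.
by apply/antichain_leP => X _; exists setT; [apply: set11 | apply: subsetT].
Qed.

HB.instance Definition _ (n : nat) :=
  Order.hasBottom.Build antichain_display (antichain n) (@antichain_le0x n).
HB.instance Definition _ (n : nat) :=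
  Order.hasTop.Build antichain_display (antichain n) (@antichain_lex1 n).

Lemma antichain_botE (n : nat) : antichain_set (\bot : antichain n) = set0.
Proof. by []. Qed.

Lemma antichain_topE (n : nat) :
  antichain_set (\top : antichain n) = [set [set: 'I_n]].
Proof. by []. Qed.

Definition antichain_interval (n : nat) (a b : antichain n) :
    {set antichain n} :=
  [set x | a <= x <= b].

Definition antichain_diff (n : nat) (a b : antichain n) : {set {set 'I_n}} :=
  antichain_set b :\: antichain_set a.

Definition directly_connected (n : nat) (a b : antichain n) :
    rel {set 'I_n} :=
  [rel A B | [&& A \in antichain_diff a b, B \in antichain_diff a b
               & ~~ (antichain1 (A :&: B) <= a)]].

(* [connect] is the reflexive transitive closure; when a <= b every set of
   b - a is directly connected to itself, so reflexivity adds no edge. *)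
Definition connected (n : nat) (a b : antichain n) : rel {set 'I_n} :=
  [rel A B | [&& A \in antichain_diff a b, B \in antichain_diff a b
               & connect (directly_connected a b) A B]].

Definition num_components (n : nat) (a b : antichain n) : nat :=
  n_comp (connected a b) (antichain_diff a b).

(* Main.v *)
From HB Require Import structures.
Require Import Defs.
From mathcomp Require Import all_boot all_order.

Import Order.TTheory.

Set Implicit Arguments.
Unset Strict Implicit.
Unset Printing Implicit Defensive.

(** The map sending an antichain [a] to the family [lower a] of all sets below
    a member of [a] is an isomorphism onto the lattice of down-closed
    families, where order is inclusion, meet is intersection and join is union.

    A down-closed family of subsets of an (n+1)-element set is the same thing
    as a pair [y <= x] of such families over n elements: the members that
    contain the extra point ([y]) and those that avoid it ([x]).  Doing this
    twice turns an antichain over n+2 points into a quadruple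
    [bottom <= x, y <= top], in which, for fixed [x] and [y], the lower corner
    ranges over [[\bot, x /\ y]] and the upper one over [[x \/ y, \top]]
    ([dedekind_addn2]).  Grouping the pairs (x, y) by their meet [a] and join
    [b], it remains to see that each [a <= b] arises from exactly
    [2 ^ num_components a b] pairs ([card_splittings]).

    Such a pair splits the family [lower b :\: lower a] into the part in [x]
    and the part in [y].  Since [x] and [y] are both down-closed, both parts
    are unions of components of the comparability graph of that family.
    Every member of it lies below a set of [b - a], and two sets [A], [B] of
    [b - a] have a common lower bound outside [lower a] exactly when [A :&: B]
    is one, that is, when they are directly connected.  So a splitting amounts
    to a set of sets of [b - a] that is closed under direct connection, and
    there are two choices for each component ([card_closed_subsets]). *)

(** * Closed vertex sets of a graph *)

(** A closed set is determined by the component representatives that it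
    contains, and these can be prescribed arbitrarily. *)
Lemma card_closed_subsets (V : finType) (e : rel V) (D : {set V}) :
  connect_sym e -> closed e D ->
  #|[set T : {set V} | T \subset D &
      [forall x, forall y, e x y ==> ((x \in T) == (y \in T))]]|
    = 2 ^ n_comp e D.
Proof.
move=> e_sym clD.
pose R := [set x in D | roots e x].
have -> : n_comp e D = #|R| by apply: eq_card => x; rewrite !inE andbC.
rewrite -card_powerset.
pose f (T : {set V}) := [set x in D | root e x \in T].
have rootD x : (root e x \in D) = (x \in D).
  by rewrite -(closed_connect clD (connect_root e x)).
have fK : {in powerset R, cancel f (fun T => T :&: R)}.
  move=> T; rewrite powersetE => /subsetP TR; apply/setP => x; rewrite !inE.
  apply/idP/idP => [/and3P[/andP[_ xT] _ /eqP rx]|xT]; first by rewrite -rx.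
  by have := TR x xT; rewrite inE => /andP[xD rx]; rewrite xD rx (eqP rx) xT.
rewrite -(card_in_imset (can_in_inj fK)); apply: eq_card => T; rewrite inE.
apply/andP/imsetP => [[TD /forallP clT]|[S]].
  have {}clT : closed e T.
    by move=> x y exy; apply/eqP/(implyP (forallP (clT x) y)).
  exists (T :&: R); first by rewrite powersetE subsetIr.
  apply/setP => x; rewrite !inE (roots_root e_sym x) andbT rootD.
  rewrite -(closed_connect clT (connect_root e x)).
  by case xT: (x \in T); rewrite ?andbF // (subsetP TD x xT).
rewrite powersetE => /subsetP SR ->; split.
  by apply/subsetP => x; rewrite inE => /andP[].
apply/forallP => x; apply/forallP => y; apply/implyP => exy.
rewrite !inE (clD x y exy).
by have /(rootP e_sym) -> : connect e x y by apply: connect1.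
Qed.

(** * Antichains as down-closed families *)

(** Locked, lest rewriting with [inE] expose the existential; membership goes
    through [lowerP]. *)
HB.lock Definition lower (T : finType) (F : {set {set T}}) : {set {set T}} :=
  [set X : {set T} | [exists Y in F, X \subset Y]].

Section Lower.
Variable T : finType.
Implicit Types (X Y : {set T}) (F G : {set {set T}}).

Definition down_closed F : Prop :=
  forall X Y, X \subset Y -> Y \in F -> X \in F.

Definition maximals F := [set X | maxset (fun Y : {set T} => Y \in F) X].

Lemma lowerP F X :
  reflect (exists2 Y, Y \in F & X \subset Y) (X \in lower F).
Proof. by rewrite lower.unlock inE; apply: exists_inP. Qed.

Lemma sub_lower F : F \subset lower F.
Proof. by apply/subsetP => X XF; apply/lowerP; exists X. Qed.

Lemma lower_down F : down_closed (lower F).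
Proof.
move=> X Y XY /lowerP[Z ZF YZ]; apply/lowerP; exists Z => //.
exact: subset_trans YZ.
Qed.

Lemma down_closedI F G :
  down_closed F -> down_closed G -> down_closed (F :&: G).
Proof.
move=> dF dG X Y XY; rewrite !inE => /andP[YF YG].
by rewrite (dF X Y) ?(dG X Y).
Qed.

Lemma down_closedU F G :
  down_closed F -> down_closed G -> down_closed (F :|: G).
Proof.
move=> dF dG X Y XY; rewrite !inE => /orP[YF|YG].
  by rewrite (dF X Y).
by rewrite (dG X Y) // orbT.
Qed.

Lemma lower_maximals F : down_closed F -> lower (maximals F) = F.
Proof.
move=> dF; apply/setP => X; apply/lowerP/idP => [[Y]|XF].
  by rewrite inE => /maxsetp YF XY; apply: dF YF.
have [Y maxY XY] := @maxset_exists _ (fun Y => Y \in F) X XF.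
by exists Y; rewrite ?inE.
Qed.

End Lower.

Section AntichainLower.
Variable n : nat.
Implicit Types (a b x y : antichain n) (F : {set {set 'I_n}}).

Lemma maximals_antichain F : is_antichain (maximals F).
Proof.
apply/forall_inP => X; rewrite inE => /maxsetP[_ maxX].
apply/forall_inP => Y; rewrite inE => /maxsetp YF; apply/implyP => XY.
by rewrite (maxX Y).
Qed.

(** The inverse of [lower] on down-closed families. *)
Definition max_antichain F : antichain n := Antichain (maximals_antichain F).

Lemma lower_max F : down_closed F -> lower (max_antichain F) = F.
Proof. exact: lower_maximals. Qed.

Lemma antichain_le_lower a b : (a <= b)%O = (lower a \subset lower b).
Proof.
apply/antichain_leP/subsetP => [ab X /lowerP[Y /ab[Z Zb YZ] XY]|ab X Xa].
  by apply/lowerP; exists Z => //; apply: subset_trans YZ.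
by apply/lowerP/ab/(subsetP (sub_lower a)).
Qed.

Lemma antichain1_le X a : (antichain1 X <= a)%O = (X \in lower a).
Proof.
apply/antichain_leP/lowerP => [le_Xa|[Y Ya XY] Z /set1P->]; last by exists Y.
by apply: le_Xa; apply: set11.
Qed.

Lemma lower_inj : injective (fun a => lower a).
Proof.
by move=> a b eq_ab; apply/eqP; rewrite eq_le !antichain_le_lower eq_ab subxx.
Qed.

Definition ameet x y := max_antichain (lower x :&: lower y).
Definition ajoin x y := max_antichain (lower x :|: lower y).

Lemma lower_meet x y : lower (ameet x y) = lower x :&: lower y.
Proof. by apply/lower_max/down_closedI; apply: lower_down. Qed.

Lemma lower_join x y : lower (ajoin x y) = lower x :|: lower y.
Proof. by apply/lower_max/down_closedU; apply: lower_down. Qed.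

Lemma le_ameet z x y : (z <= ameet x y)%O = (z <= x)%O && (z <= y)%O.
Proof. by rewrite !antichain_le_lower lower_meet subsetI. Qed.

Lemma ge_ajoin z x y : (ajoin x y <= z)%O = (x <= z)%O && (y <= z)%O.
Proof. by rewrite !antichain_le_lower lower_join subUset. Qed.

Lemma ameet_le_ajoin x y : (ameet x y <= ajoin x y)%O.
Proof.
rewrite antichain_le_lower lower_meet lower_join.
by apply: subset_trans (subsetUl _ _); apply: subsetIl.
Qed.

End AntichainLower.

(** * Adding one point to the ground set *)

Section AddPoint.
Variable n : nat.
Implicit Types (X Y : {set 'I_n}) (Z : {set 'I_n.+1}).
Implicit Types (c : bool) (x y : antichain n) (z : antichain n.+1).

Definition cons_set (c : bool) X : {set 'I_n.+1} :=
  [set i | if unlift ord0 i is Some j then j \in X else c].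

Definition tail_set Z : {set 'I_n} := lift ord0 @^-1: Z.

Lemma mem_cons_set0 c X : (ord0 \in cons_set c X) = c.
Proof. by rewrite inE unlift_none. Qed.

Lemma cons_setK c X : tail_set (cons_set c X) = X.
Proof. by apply/setP => i; rewrite !inE liftK. Qed.

Lemma tail_setK Z : cons_set (ord0 \in Z) (tail_set Z) = Z.
Proof. by apply/setP => i; rewrite inE; case: unliftP => [j|] ->; rewrite ?inE. Qed.

Lemma tail_setS Z Z' : Z \subset Z' -> tail_set Z \subset tail_set Z'.
Proof. exact: preimsetS. Qed.

Lemma cons_setS c c' X Y :
  (c -> c') -> X \subset Y -> cons_set c X \subset cons_set c' Y.
Proof.
move=> cc' /subsetP XY; apply/subsetP => i; rewrite !inE.
by case: unlift => [j|] //; apply: XY.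
Qed.

Definition slice c z : antichain n :=
  max_antichain [set X | cons_set c X \in lower z].

Definition glue x y : antichain n.+1 :=
  max_antichain [set Z | tail_set Z \in lower (if ord0 \in Z then y else x)].

Lemma mem_lower_slice c z X :
  (X \in lower (slice c z)) = (cons_set c X \in lower z).
Proof.
rewrite lower_max ?inE // => A B AB; rewrite !inE.
by apply: lower_down; apply: cons_setS.
Qed.

(** Adding the extra point to a member moves the test from [x] to [y], so the
    glued family is down-closed only because [y <= x]. *)
Lemma mem_lower_glue x y Z : (y <= x)%O ->
  (Z \in lower (glue x y)) =
    (tail_set Z \in lower (if ord0 \in Z then y else x)).
Proof.
rewrite antichain_le_lower => /subsetP yx; rewrite lower_max ?inE // => A B AB.
rewrite !inE => /(lower_down (tail_setS AB)).
case: ifPn => [B0|B0].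
  by case: ifP => // _; apply: yx.
by rewrite (contraNF (subsetP AB _) B0).
Qed.

Lemma slice_le z : (slice true z <= slice false z)%O.
Proof.
rewrite antichain_le_lower; apply/subsetP => X; rewrite !mem_lower_slice.
by apply: lower_down; apply: cons_setS.
Qed.

Lemma glueK x y c : (y <= x)%O -> slice c (glue x y) = if c then y else x.
Proof.
move=> yx; apply/lower_inj/setP => X.
by rewrite mem_lower_slice mem_lower_glue // cons_setK mem_cons_set0.
Qed.

Lemma sliceK z : glue (slice false z) (slice true z) = z.
Proof.
apply/lower_inj/setP => Z; rewrite mem_lower_glue ?slice_le //.
rewrite -[in RHS](tail_setK Z).
by case: ifP => _; rewrite mem_lower_slice.
Qed.

Lemma slice_mono c z z' : (z <= z')%O -> (slice c z <= slice c z')%O.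
Proof.
rewrite !antichain_le_lower => /subsetP zz'; apply/subsetP => X.
by rewrite !mem_lower_slice; apply: zz'.
Qed.

Lemma glue_le x y x' y' : (y <= x)%O -> (y' <= x')%O ->
  (glue x y <= glue x' y')%O = (x <= x')%O && (y <= y')%O.
Proof.
move=> yx yx'; apply/idP/andP => [le_glue|[xx' yy']].
  have := slice_mono false le_glue; have := slice_mono true le_glue.
  by rewrite !glueK.
move: xx' yy'; rewrite !antichain_le_lower => /subsetP xx' /subsetP yy'.
apply/subsetP => Z; rewrite !mem_lower_glue //.
by case: ifP => _; [apply: yy' | apply: xx'].
Qed.

(** An antichain over one more point is a comparable pair of antichains: its
    two slices, from which it is glued. *)
Lemma sum_antichainS (g : antichain n.+1 -> nat) :
  \sum_z g z = \sum_x \sum_(y | (y <= x)%O) g (glue x y).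
Proof.
rewrite pair_big_dep /=.
rewrite (reindex_onto (fun p => glue p.1 p.2)
                      (fun z => (slice false z, slice true z))) /=; last first.
  by move=> z _; apply: sliceK.
apply: eq_bigl => -[x y] /=; apply/eqP/idP => [[ex ey]|yx].
  by have := slice_le (glue x y); rewrite ex ey.
by rewrite !glueK.
Qed.

End AddPoint.

(** The four slices of an antichain over two extra points form a square with
    lower corner [l], upper corner [u] and middle corners [x] and [y].  The
    only order conditions between them are the four sides of the square, which
    say that [l] is below the meet and [u] above the join of [x] and [y]. *)
Lemma dedekind_addn2 (n : nat) :
  dedekind n.+2 =
  \sum_(p : antichain n * antichain n)
    #|antichain_interval (\bot)%O (ameet p.1 p.2)|
      * #|antichain_interval (ajoin p.1 p.2) (\top)%O|.
Proof.
rewrite /dedekind -sum1_card sum_antichainS.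
under eq_bigr => w _ do rewrite big_mkcond /= sum_antichainS.
rewrite sum_antichainS.
transitivity (\sum_(u : antichain n) \sum_(y : antichain n)
  \sum_(x : antichain n) \sum_(l : antichain n)
    (l <= ameet x y)%O * (ajoin x y <= u)%O).
  apply: eq_bigr => u _; rewrite big_mkcond; apply: eq_bigr => y _.
  case: ifPn => [yu|yu]; last first.
    rewrite big1 // => x _; rewrite big1 // => l _.
    by rewrite ge_ajoin (negPf yu) andbF muln0.
  apply: eq_bigr => x _; rewrite big_mkcond; apply: eq_bigr => l _.
  rewrite le_ameet ge_ajoin yu andbT.
  case: ifPn => // lx; rewrite glue_le // mulnb andbC.
  by case: (_ && _).
rewrite exchange_big /=.
under eq_bigr => y _ do rewrite exchange_big /=.
rewrite exchange_big pair_big /=; apply: eq_bigr => -[x y] _ /=.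
rewrite exchange_big -!sum1_card big_distrl [RHS]big_mkcond /=.
apply: eq_bigr => l _; rewrite inE le0x /=; case: (_ <= _)%O; last first.
  by rewrite big1 // => u _; rewrite mul0n.
rewrite mul1n [RHS]big_mkcond; apply: eq_bigr => u _.
by rewrite inE lex1 andbT mul1n; case: (_ <= _)%O.
Qed.

(** * Pairs of antichains with given meet and join *)

Section Splittings.
Variables (n : nat) (a b : antichain n).
Hypothesis le_ab : (a <= b)%O.

Local Notation D := (antichain_diff a b).
Implicit Types (A B X : {set 'I_n}) (S : {set {set 'I_n}}).

(** A set of [b] below some set of [a] is also below a set of [b], through that
    set of [a]; incomparability in [b] makes all three equal. *)
Lemma diff_notin_lower A : A \in D -> A \notin lower a.
Proof.
rewrite inE => /andP[Aa Ab]; apply: contra Aa => /lowerP[Y Ya AY].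
have /antichain_leP/(_ Y Ya)[Z Zb YZ] := le_ab.
have /implyP/(_ (subset_trans AY YZ))/eqP eqAZ :=
  forall_inP (forall_inP (antichainP b) A Ab) Z Zb.
suff -> : A = Y by [].
by apply/eqP; rewrite eqEsubset AY {1}eqAZ.
Qed.

Lemma lower_diff_above X :
  X \in lower b -> X \notin lower a -> exists2 A, A \in D & X \subset A.
Proof.
move=> /lowerP[A Ab XA] Xa; exists A => //; rewrite inE Ab andbT.
by apply: contra Xa => Aa; apply/lowerP; exists A.
Qed.

Lemma directly_connectedE A B :
  directly_connected a b A B = [&& A \in D, B \in D & A :&: B \notin lower a].
Proof. by rewrite -antichain1_le. Qed.

Lemma directly_connected_sym : symmetric (directly_connected a b).
Proof. by move=> A B; rewrite !directly_connectedE setIC andbCA. Qed.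

Lemma connectedE A B :
  connected a b A B =
    [&& A \in D, B \in D & connect (directly_connected a b) A B].
Proof. by []. Qed.

Lemma connected_connect_sym : connect_sym (connected a b).
Proof.
apply: sym_connect_sym => A B.
by rewrite !connectedE andbCA (sym_connect_sym directly_connected_sym).
Qed.

Lemma closed_connected_diff : closed (connected a b) D.
Proof. by move=> A B /and3P[-> ->]. Qed.

Definition connection_closed S :=
  (S \subset D) &&
  [forall A, forall B, connected a b A B ==> ((A \in S) == (B \in S))].

(** Closure under single direct connections suffices, since [connected] is
    generated by them. *)
Lemma connection_closedP S :
  reflect (S \subset D /\ forall A B, A \in D -> B \in D ->
             A :&: B \notin lower a -> A \in S -> B \in S)
          (connection_closed S).
Proof.
apply: (iffP andP) => -[SD clS]; split=> //.
  move=> A B AD BD ABa AS.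
  suff AB : connected a b A B.
    by rewrite -(eqP (implyP (forallP (forallP clS A) B) AB)).
  rewrite connectedE AD BD; apply: connect1.
  by rewrite directly_connectedE AD BD.
have {}clS : closed (directly_connected a b) S.
  apply: intro_closed; first exact: sym_connect_sym directly_connected_sym.
  by move=> A B; rewrite directly_connectedE => /and3P[AD BD]; apply: clS.
apply/forallP => A; apply/forallP => B; apply/implyP => /and3P[_ _ AB].
by rewrite (closed_connect clS AB).
Qed.

(** The candidate pair with meet [a] and join [b] whose first half contains
    exactly the sets [S] of [b - a]. *)
Definition splitting S : antichain n * antichain n :=
  (max_antichain (lower a :|: lower S),
   max_antichain (lower a :|: lower (D :\: S))).

Lemma lower_splitting S :
  (lower (splitting S).1 = lower a :|: lower S) *
  (lower (splitting S).2 = lower a :|: lower (D :\: S)).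
Proof. by split; apply/lower_max/down_closedU; apply: lower_down. Qed.

Definition splittings :=
  [set p : antichain n * antichain n | (ameet p.1 p.2 == a) && (ajoin p.1 p.2 == b)].

Lemma splittingsP (p : antichain n * antichain n) :
  reflect (lower p.1 :&: lower p.2 = lower a /\
           lower p.1 :|: lower p.2 = lower b)
          (p \in splittings).
Proof.
rewrite inE -lower_meet -lower_join.
apply: (iffP andP) => [[/eqP-> /eqP->]|[/lower_inj-> /lower_inj->]] //.
Qed.

(** A set outside [lower a] that lies below both [A] in [S] and [B] outside
    [S] would directly connect them; hence the two halves meet in [a] only. *)
Lemma splitting_in S : connection_closed S -> splitting S \in splittings.
Proof.
move=> /connection_closedP[SD clS]; apply/splittingsP.
rewrite !lower_splitting -setUIr; split.
  apply/setUidPl/subsetP => X /setIP[/lowerP[A AS XA] /lowerP[B BDS XB]].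
  have /setDP[BD BS] := BDS; apply: contraNT BS => Xa.
  apply: (clS A) => //; first exact: (subsetP SD).
  by apply: contra Xa; apply: lower_down; rewrite subsetI XA.
apply/setP => X; rewrite setUACA setUid; apply/idP/idP.
  have lower_ab : lower a \subset lower b by rewrite -antichain_le_lower.
  have Db : D \subset b by apply: subsetDl.
  case/setUP => [/(subsetP lower_ab)//|/setUP[]/lowerP[A AS XA]]; apply/lowerP.
    by exists A => //; apply/(subsetP Db)/(subsetP SD).
  by exists A => //; apply/(subsetP Db); case/setDP: AS.
move=> Xb; case: (boolP (X \in lower a)) => [Xa|Xa]; apply/setUP; [by left|right].
have [A AD XA] := lower_diff_above Xb Xa.
apply/setUP; case: (boolP (A \in S)) => AS; [left|right]; apply/lowerP.
  by exists A.
by exists A => //; apply/setDP.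
Qed.

Lemma splittingK :
  {in [set S | connection_closed S],
    cancel splitting (fun p => D :&: lower p.1)}.
Proof.
move=> S; rewrite inE => clS; have /connection_closedP[SD _] := clS.
have /splittingsP[spI spU] := splitting_in clS.
apply/setP => A; apply/setIP/idP => [[AD A1]|AS].
  apply: contraT => AS; have := diff_notin_lower AD.
  rewrite -spI inE A1 lower_splitting inE.
  by rewrite (subsetP (sub_lower (D :\: S))) ?orbT //; apply/setDP.
split; first exact: (subsetP SD).
by rewrite lower_splitting inE (subsetP (sub_lower S)) ?orbT.
Qed.

(** A set [X] of one half [x] outside [lower a] lies below some [A] of [b - a].
    Were [A] in the other half, so would [X] be, putting it in the meet.  Hence
    [A] is in [x], and [x] is recovered from the sets of [b - a] in it. *)
Lemma splitting_surj (p : antichain n * antichain n) : p \in splittings ->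
  connection_closed (D :&: lower p.1) /\ p = splitting (D :&: lower p.1).
Proof.
case: p => x y /splittingsP[/= spI spU].
have half u v : lower u :&: lower v = lower a ->
    lower u :|: lower v = lower b -> lower u = lower a :|: lower (D :&: lower u).
  move=> uvI uvU; apply/setP => X; apply/idP/setUP => [Xu|[|/lowerP[A]]].
  - case: (boolP (X \in lower a)) => Xa; [by left|right].
    have Xb : X \in lower b by rewrite -uvU inE Xu.
    have [A AD XA] := lower_diff_above Xb Xa.
    apply/lowerP; exists A => //; rewrite inE AD /=.
    have : A \in lower b by apply: (subsetP (sub_lower b)); case/setDP: AD.
    rewrite -uvU => /setUP[//|/(lower_down XA) Xv].
    by case/negP: Xa; rewrite -uvI inE Xu.
  - by rewrite -uvI => /setIP[].
  - by move=> /setIP[_ Au] XA; apply: lower_down Au.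
have DE : D :\: (D :&: lower x) = D :&: lower y.
  apply/setP => A; rewrite setDIr setDv set0U; apply/setDP/setIP => -[AD].
    move=> Ax; split=> //.
    have : A \in lower b by apply: (subsetP (sub_lower b)); case/setDP: AD.
    by rewrite -spU => /setUP[Ax'|//]; rewrite Ax' in Ax.
  move=> Ay; split=> //; apply: contra (diff_notin_lower AD) => Ax.
  by rewrite -spI inE Ax.
split.
  apply/connection_closedP; split; first exact: subsetIl.
  move=> A B AD BD ABa /setIP[_ Ax].
  apply: contraT => BS; have : B \in D :\: (D :&: lower x) by apply/setDP.
  rewrite DE => /setIP[_ By]; case/negP: ABa; rewrite -spI inE.
  by rewrite (lower_down (subsetIl A B)) ?(lower_down (subsetIr A B)).
have [E1 E2] := lower_splitting (D :&: lower x).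
rewrite [RHS]surjective_pairing; congr pair; apply: lower_inj.
  by rewrite E1 -(half x y).
by rewrite E2 DE -(half y x) // 1?setIC // setUC.
Qed.

Lemma card_splittings : #|splittings| = 2 ^ num_components a b.
Proof.
rewrite -(card_closed_subsets connected_connect_sym closed_connected_diff).
rewrite -(card_in_imset (can_in_inj splittingK)).
apply: eq_card => p; apply/idP/imsetP => [/splitting_surj[clS ->]|[S]].
  by exists (D :&: lower p.1); rewrite ?inE.
by rewrite inE => clS ->; apply: splitting_in.
Qed.

End Splittings.

Theorem theorem6p1 (n : nat) :
  dedekind n.+2 =
  \sum_(a : antichain n) \sum_(b : antichain n | (a <= b)%O)
    2 ^ num_components a b
      * #|antichain_interval (\bot)%O a| * #|antichain_interval b (\top)%O|.
Proof.
rewrite dedekind_addn2 pair_big_dep /=.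
rewrite (partition_big (fun p => (ameet p.1 p.2, ajoin p.1 p.2))
           (fun q => (q.1 <= q.2)%O)) /=; last by move=> p _; apply: ameet_le_ajoin.
apply: eq_bigr => -[a b] /= le_ab; rewrite -mulnA -card_splittings //.
rewrite -sum_nat_const; apply: eq_big => [p|p /eqP[-> ->]] //.
by rewrite inE -xpair_eqE.
Qed.
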